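(* For every real $\nu>-1$ and every $\tau>1/2$, the function $x\mapsto W_\nu(x^\tau)$ is not a Bernstein function on $(0,\infty)$, where $W_\nu(z)=\dfrac{zI_\nu(z)}{I_{\nu+1}(z)}$ for $z>0$.
   Context: $I_\mu$ is the modified Bessel function of the first kind of order $\mu>-1$: for $z>0$, $I_\mu(z)=\sum_{k\ge0}\frac{(z/2)^{2k+\mu}}{k!\,\Gamma(k+\mu+1)}$. A function $f:(0,\infty)\to[0,\infty)$ is completely monotone if $f\in C^\infty$ and $(-1)^nf^{(n)}(x)\ge0$ for all integers $n\ge0$ and all $x>0$. A function $g:(0,\infty)\to[0,\infty)$ is a Bernstein function if $g\in C^\infty$ and $g'$ is completely monotone. *)

(* Defs.v *)
From Stdlib Require Import Reals Factorial.
From Coquelicot Require Import Coquelicot.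
Open Scope R_scope.

(* Functions on (0, +oo) are represented by total functions R -> R of which
   only the values at positive arguments are constrained; since (0, +oo) is
   open, derivatives at positive points depend on those values only. *)

(* Euler's integral, improper at both endpoints; it converges for 0 < s,
   which covers every argument s = k + mu + 1 with -1 < mu below. *)
Definition Gamma (s : R) : R :=
  RInt_gen (fun t : R => Rpower t (s - 1) * exp (- t))
    (at_right 0) (Rbar_locally p_infty).

Definition BesselI (mu z : R) : R :=
  Series (fun k : nat =>
    Rpower (z / 2) (2 * INR k + mu)
      / (INR (fact k) * Gamma (INR k + mu + 1))).

Definition smooth_pos (f : R -> R) : Prop :=
  forall (n : nat) (x : R), 0 < x -> ex_derive_n f n x.

Definition completely_monotone (f : R -> R) : Prop :=
  (forall x : R, 0 < x -> 0 <= f x) /\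
  smooth_pos f /\
  (forall (n : nat) (x : R), 0 < x -> 0 <= (-1) ^ n * Derive_n f n x).

Definition Bernstein (g : R -> R) : Prop :=
  (forall x : R, 0 < x -> 0 <= g x) /\
  smooth_pos g /\
  completely_monotone (Derive g).

Definition W (nu z : R) : R := z * BesselI nu z / BesselI (nu + 1) z.

(* Main.v *)
Require Import Defs.
From Stdlib Require Import Reals Lra Factorial.
From Coquelicot Require Import Coquelicot.
Open Scope R_scope.

(** With [q = (z/2)^2], write [I_mu z = (z/2)^mu * S_mu q], where [S_mu] is the
entire function [sum_k q^k / (k! Gamma (k+mu+1))].  Gauss's contiguity relation
[S_nu = (nu+1) S_(nu+1) + q S_(nu+2)] (lemma [bessel_entire_rec]) turns the
quotient into
<<
  W_nu z = 2 (nu+1) + (z^2/2) * S_(nu+2) q / S_(nu+1) q,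
>>
so that [2 (nu+1) < W_nu z <= 2 (nu+1) + K z^2] for small [z] ([W_bounds]).
Hence [g x = W_nu (x^tau)] exceeds its limit [L = 2 (nu+1)] at [0] by a positive
amount that is [O(x^(2 tau))].

A Bernstein function is concave on [(0, oo)].  When [2 tau > 1] the slope of the
chords of [g] near [0] tends to [0], and by concavity these slopes dominate the
slopes of all later chords; so [g <= L] everywhere
([Bernstein_superlinear_at_0]), which contradicts [g > L] near [0].

The contiguity relation rests on [Gamma (s+1) = s Gamma s] for the improper
Riemann integral.  Convergence is shown first for [s > 1], where the integrand
is dominated by a multiple of [exp (-t/2)] on the whole half-line.  Integration
by parts between [0] and [oo] then carries convergence from [s+1] down to [s],
so it reaches the singular range [0 < s <= 1], and gives the functional equation
at the same time ([is_RInt_gen_Gamma_down]). *)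

(** * Improper integrals over the positive half-line *)

Lemma at_right_0_intro (P : R -> Prop) (d : R) :
  0 < d -> (forall x, 0 < x < d -> P x) -> at_right 0 P.
Proof.
intros Hd HP.
exists (mkposreal d Hd); intros y Hy Hy0.
apply HP; split; [exact Hy0|].
change (Rabs (y - 0) < d) in Hy.
rewrite Rabs_pos_eq in Hy; lra.
Qed.

Lemma filter_prod_0_infty_intro (P : R * R -> Prop) (a0 b0 : R) :
  0 < a0 -> (forall a b, 0 < a < a0 -> b0 < b -> P (a, b)) ->
  filter_prod (at_right 0) (Rbar_locally p_infty) P.
Proof.
intros Ha0 HP.
apply (Filter_prod _ _ _ (fun a => 0 < a < a0) (fun b => b0 < b)).
- now apply (at_right_0_intro _ a0).
- now exists b0.
- exact HP.
Qed.

Lemma ex_RInt_pos (f : R -> R) (a b : R) :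
  (forall x, 0 < x -> continuous f x) -> 0 < a -> 0 < b -> ex_RInt f a b.
Proof.
intros Hf Ha Hb.
apply (ex_RInt_continuous (V := R_CompleteNormedModule)); intros x [Hx _].
apply Hf; apply Rlt_le_trans with (2 := Hx).
now apply Rmin_glb_lt.
Qed.

Lemma RInt_mono_interval (f : R -> R) (a a' b' b : R) :
  (forall x, 0 < x -> continuous f x) -> (forall x, 0 < x -> 0 <= f x) ->
  0 < a -> a <= a' -> a' <= b' -> b' <= b ->
  RInt f a' b' <= RInt f a b.
Proof.
intros Hc Hp Ha Haa Hab Hbb.
assert (Hex : forall u v, 0 < u -> 0 < v -> ex_RInt f u v)
  by (intros; now apply ex_RInt_pos).
rewrite <- (RInt_Chasles f a a' b) by (apply Hex; lra).
rewrite <- (RInt_Chasles f a' b' b) by (apply Hex; lra).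
change (RInt f a' b' <= RInt f a a' + (RInt f a' b' + RInt f b' b)).
assert (0 <= RInt f a a')
  by (apply RInt_ge_0; [lra | apply Hex; lra | intros; apply Hp; lra]).
assert (0 <= RInt f b' b)
  by (apply RInt_ge_0; [lra | apply Hex; lra | intros; apply Hp; lra]).
lra.
Qed.

(** Monotone convergence: the integrals over compact subintervals increase with
the interval, so they converge to their supremum.  The bound by the limit is
kept in order to derive positivity of the integral from a single interval. *)
Lemma is_RInt_gen_pos_bounded (f : R -> R) (M : R) :
  (forall x, 0 < x -> continuous f x) -> (forall x, 0 < x -> 0 <= f x) ->
  (forall a b, 0 < a -> a <= b -> RInt f a b <= M) ->
  exists l, is_RInt_gen f (at_right 0) (Rbar_locally p_infty) l /\
    forall a b, 0 < a -> a <= b -> RInt f a b <= l.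
Proof.
intros Hc Hp HM.
destruct (completeness (fun v => exists a b, 0 < a /\ a <= b /\ v = RInt f a b))
  as [l [Hub Hlub]].
- exists M; intros v (a & b & Ha & Hab & ->); now apply HM.
- exists (RInt f 1 1), 1, 1; repeat split; lra.
- assert (Hle : forall a b, 0 < a -> a <= b -> RInt f a b <= l)
    by (intros a b Ha Hab; apply Hub; now exists a, b).
  exists l; split; [|exact Hle].
  intros P [eps Heps].
  assert (Hex : exists a b, 0 < a /\ a <= b /\ l - eps < RInt f a b).
  { apply Classical_Prop.NNPP; intros Hno.
    assert (l <= l - eps).
    { apply Hlub; intros v (a & b & Ha & Hab & ->).
      apply Rnot_lt_le; intros Hlt; apply Hno; now exists a, b. }
    destruct eps as [e He]; simpl in *; lra. }
  destruct Hex as (a0 & b0 & Ha0 & Hab0 & Hlt).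
  apply (filter_prod_0_infty_intro _ a0 b0); [exact Ha0|].
  intros a b [Ha Haa] Hb.
  exists (RInt f a b); split.
  + apply (RInt_correct (V := R_CompleteNormedModule)), ex_RInt_pos; simpl; auto; lra.
  + apply Heps; change (Rabs (RInt f a b - l) < eps).
    assert (RInt f a0 b0 <= RInt f a b)
      by (apply RInt_mono_interval; auto; lra).
    assert (RInt f a b <= l) by (apply Hle; lra).
    rewrite Rabs_left1; lra.
Qed.

(** * The Gamma function *)

Notation gamma_integrand s := (fun t : R => Rpower t (s - 1) * exp (- t)).

Lemma is_derive_Rpower_exp (s t : R) : 0 < t ->
  is_derive (fun x => Rpower x s * exp (- x)) t
    (s * (Rpower t (s - 1) * exp (- t)) - Rpower t s * exp (- t)).
Proof.
intros Ht.
assert (H : is_derive (fun x => Rpower x s) t (s * Rpower t (s - 1)))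
  by (apply is_derive_Reals, derivable_pt_lim_power, Ht).
assert (H' : is_derive (fun x => exp (- x)) t (- exp (- t)))
  by (auto_derive; [trivial | ring]).
replace (_ - _) with
  (plus (mult (s * Rpower t (s - 1)) (exp (- t))) (mult (Rpower t s) (- exp (- t))))
  by (unfold plus, mult; simpl; ring).
apply (is_derive_mult _ _ _ _ _ H H'); intros; apply Rmult_comm.
Qed.

Lemma continuous_Rpower_exp (s t : R) : 0 < t ->
  continuous (fun x => Rpower x s * exp (- x)) t.
Proof.
intros Ht; apply (ex_derive_continuous (fun x => Rpower x s * exp (- x))).
eexists; apply (is_derive_Rpower_exp s t Ht).
Qed.

(** From [ln u <= u] at [u = t / (2 p)], that is
[p ln t <= p ln (2 p) + t / 2]. *)
Lemma Rpower_le_exp_half (p : R) : 0 < p ->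
  exists C, 0 < C /\ forall t, 0 < t -> Rpower t p <= C * exp (t / 2).
Proof.
intros Hp; exists (exp (p * ln (2 * p))); split; [apply exp_pos|].
intros t Ht; rewrite <- exp_plus.
unfold Rpower.
assert (Hq : 0 < t / (2 * p)) by (apply Rdiv_lt_0_compat; lra).
assert (H : ln (t / (2 * p)) <= t / (2 * p)).
{ pose proof (exp_ineq1_le (ln (t / (2 * p)))) as He.
  rewrite exp_ln in He; lra. }
assert (Hl : ln t = ln (t / (2 * p)) + ln (2 * p)).
{ rewrite <- ln_mult by lra; f_equal; field; lra. }
assert (p * ln t <= p * ln (2 * p) + t / 2).
{ rewrite Hl.
  replace (t / 2) with (p * (t / (2 * p))) by (field; lra).
  nra. }
destruct (Rle_lt_or_eq_dec _ _ H0) as [H1|H1].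
- now apply Rlt_le, exp_increasing.
- rewrite H1; apply Rle_refl.
Qed.

Lemma Rpower_exp_le (p : R) : 0 < p ->
  exists C, 0 < C /\ forall t, 0 < t ->
    Rpower t p * exp (- t) <= C * exp (- (t / 2)).
Proof.
intros Hp; destruct (Rpower_le_exp_half p Hp) as (C & HC & H).
exists C; split; [exact HC|]; intros t Ht.
replace (C * exp (- (t / 2))) with (C * exp (t / 2) * exp (- t)).
- apply Rmult_le_compat_r; [apply Rlt_le, exp_pos | now apply H].
- rewrite Rmult_assoc, <- exp_plus; do 2 f_equal; lra.
Qed.

Lemma Gamma_converges_gt1 (s : R) : 1 < s ->
  exists l, 0 < l /\
    is_RInt_gen (gamma_integrand s) (at_right 0) (Rbar_locally p_infty) l.
Proof.
intros Hs.
destruct (Rpower_exp_le (s - 1)) as (C & HC & Hle); [lra|].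
destruct (is_RInt_gen_pos_bounded (gamma_integrand s) (2 * C)) as (l & Hl & Hpart).
- intros x Hx; now apply continuous_Rpower_exp.
- intros x Hx; apply Rlt_le, Rmult_lt_0_compat; apply exp_pos.
- intros a b Ha Hab.
  assert (Hprim : is_RInt (fun t => C * exp (- (t / 2))) a b
     (minus (- (2 * C) * exp (- (b / 2))) (- (2 * C) * exp (- (a / 2))))).
  { apply (is_RInt_derive (fun t => - (2 * C) * exp (- (t / 2)))).
    - intros x _; auto_derive; [trivial|]; unfold Rdiv; field.
    - intros x _; apply (ex_derive_continuous (fun t => C * exp (- (t / 2)))).
      auto_derive; trivial. }
  apply Rle_trans with (RInt (fun t => C * exp (- (t / 2))) a b).
  + apply RInt_le; [exact Hab | | eexists; exact Hprim |].
    * apply ex_RInt_pos; [intros x Hx; now apply continuous_Rpower_exp | lra | lra].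
    * intros x Hx; apply Hle; lra.
  + rewrite (is_RInt_unique _ _ _ _ Hprim).
    unfold minus, plus, opp; simpl.
    assert (0 < exp (- (b / 2))) by apply exp_pos.
    assert (exp (- (a / 2)) < 1)
      by (rewrite <- exp_0; apply exp_increasing; lra).
    nra.
- exists l; split; [|exact Hl].
  apply Rlt_le_trans with (RInt (gamma_integrand s) 1 2); [|apply Hpart; lra].
  apply RInt_gt_0; [lra | |].
  + intros; apply Rmult_lt_0_compat; apply exp_pos.
  + intros; apply continuous_Rpower_exp; lra.
Qed.

Lemma Rpower_exp_lim_0 (s : R) : 0 < s ->
  filterlim (fun t => Rpower t s * exp (- t)) (at_right 0) (locally 0).
Proof.
intros Hs P [eps Heps].
apply (at_right_0_intro _ (Rpower eps (/ s))); [apply exp_pos|].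
intros t [Ht Hlt]; apply Heps.
change (Rabs (Rpower t s * exp (- t) - 0) < eps).
assert (0 < Rpower t s) by apply exp_pos.
assert (0 < exp (- t)) by apply exp_pos.
assert (exp (- t) < 1) by (rewrite <- exp_0; apply exp_increasing; lra).
rewrite Rminus_0_r, Rabs_pos_eq by nra.
apply Rlt_trans with (Rpower t s); [nra|].
replace (pos eps) with (Rpower (Rpower eps (/ s)) s).
- now apply Rlt_Rpower_l.
- rewrite Rpower_mult, Rinv_l by lra; apply Rpower_1; apply cond_pos.
Qed.

Lemma Rpower_exp_lim_infty (s : R) : 0 < s ->
  filterlim (fun t => Rpower t s * exp (- t)) (Rbar_locally p_infty) (locally 0).
Proof.
intros Hs; destruct (Rpower_exp_le s Hs) as (C & HC & Hle).
intros P [eps Heps].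
assert (He := cond_pos eps).
exists (Rmax 0 (- 2 * ln (eps / C))); intros t Ht.
apply Heps; change (Rabs (Rpower t s * exp (- t) - 0) < eps).
assert (Ht0 : 0 < t) by (apply Rle_lt_trans with (2 := Ht), Rmax_l).
assert (Ht1 : - 2 * ln (eps / C) < t) by (apply Rle_lt_trans with (2 := Ht), Rmax_r).
assert (0 < Rpower t s * exp (- t)) by (apply Rmult_lt_0_compat; apply exp_pos).
rewrite Rminus_0_r, Rabs_pos_eq by lra.
apply Rle_lt_trans with (1 := Hle t Ht0).
replace (pos eps) with (C * exp (ln (eps / C))).
- apply Rmult_lt_compat_l; [exact HC|]; apply exp_increasing; lra.
- rewrite exp_ln by (apply Rdiv_lt_0_compat; lra); field; lra.
Qed.

(** Integration by parts: [t^s exp (-t)] vanishes at both ends, so its derivative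
[s t^(s-1) exp (-t) - t^s exp (-t)] has integral [0]; adding the integral for
[s+1] and dividing by [s] leaves the one for [s].  Read downwards, this needs
convergence at [s+1] only. *)
Lemma is_RInt_gen_Gamma_down (s l : R) : 0 < s ->
  is_RInt_gen (gamma_integrand (s + 1)) (at_right 0) (Rbar_locally p_infty) l ->
  is_RInt_gen (gamma_integrand s) (at_right 0) (Rbar_locally p_infty) (l / s).
Proof.
intros Hs Hl.
set (F := fun t => Rpower t s * exp (- t)).
assert (HF : forall t, 0 < t ->
  Derive F t = s * (Rpower t (s - 1) * exp (- t)) - Rpower t s * exp (- t))
  by (intros t Ht; apply is_derive_unique, is_derive_Rpower_exp, Ht).
assert (Hpos : forall a b x, 0 < a < 1 -> 1 < b -> Rmin a b <= x -> 0 < x).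
{ intros a b x Ha Hb Hx; apply Rlt_le_trans with (2 := Hx).
  apply Rmin_glb_lt; lra. }
assert (HD : is_RInt_gen (Derive F) (at_right 0) (Rbar_locally p_infty) (0 - 0)).
{ apply is_RInt_gen_Derive.
  - apply (filter_prod_0_infty_intro _ 1 1); [lra|].
    intros a b Ha Hb x [Hx _]; simpl in Hx.
    eexists; apply is_derive_Rpower_exp; eauto.
  - apply (filter_prod_0_infty_intro _ 1 1); [lra|].
    intros a b Ha Hb x [Hx _]; simpl in Hx.
    assert (Hx0 : 0 < x) by eauto.
    apply (continuous_ext_loc _ (fun t =>
      minus (scal s (Rpower t (s - 1) * exp (- t))) (Rpower t s * exp (- t)))).
    + exists (mkposreal x Hx0); intros y Hy.
      change (Rabs (y - x) < x) in Hy; apply Rabs_def2 in Hy.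
      rewrite HF by lra; reflexivity.
    + apply (continuous_minus (V := R_NormedModule)).
      * apply (continuous_scal_r (V := R_NormedModule)).
        now apply continuous_Rpower_exp.
      * now apply continuous_Rpower_exp.
  - now apply Rpower_exp_lim_0.
  - now apply Rpower_exp_lim_infty. }
assert (H := is_RInt_gen_scal _ (/ s) _ (is_RInt_gen_plus _ _ _ _ HD Hl)).
replace (l / s) with (scal (/ s) (plus (0 - 0) l))
  by (unfold scal, plus; simpl; unfold mult; simpl; field; lra).
revert H; apply is_RInt_gen_ext.
apply (filter_prod_0_infty_intro _ 1 1); [lra|].
intros a b Ha Hb x [Hx _]; simpl in Hx.
rewrite HF by (apply (Hpos a b); auto; lra).
replace (s + 1 - 1) with s by ring.
unfold scal, plus; simpl; unfold mult; simpl; field; lra.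
Qed.

Lemma Gamma_converges (s : R) : 0 < s ->
  exists l, 0 < l /\
    is_RInt_gen (gamma_integrand s) (at_right 0) (Rbar_locally p_infty) l.
Proof.
intros Hs; destruct (Gamma_converges_gt1 (s + 1)) as (l & Hl & H); [lra|].
exists (l / s); split; [now apply Rdiv_lt_0_compat|].
now apply is_RInt_gen_Gamma_down.
Qed.

Lemma Gamma_eq (s l : R) :
  is_RInt_gen (gamma_integrand s) (at_right 0) (Rbar_locally p_infty) l ->
  Gamma s = l.
Proof.
intros H; unfold Gamma.
exact (is_RInt_gen_unique
  (FFa := Proper_StrongProper _ (at_right_proper_filter 0))
  (FFb := Proper_StrongProper _ (Rbar_locally_filter p_infty)) _ l H).
Qed.

Lemma Gamma_pos (s : R) : 0 < s -> 0 < Gamma s.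
Proof.
intros Hs; destruct (Gamma_converges s Hs) as (l & Hl & H).
now rewrite (Gamma_eq s l H).
Qed.

Lemma Gamma_succ (s : R) : 0 < s -> Gamma (s + 1) = s * Gamma s.
Proof.
intros Hs; destruct (Gamma_converges (s + 1)) as (l & Hl & H); [lra|].
rewrite (Gamma_eq _ _ H), (Gamma_eq s (l / s)); [field; lra|].
now apply is_RInt_gen_Gamma_down.
Qed.
(** * Concavity of Bernstein functions *)

(** The three-chord inequality: by the mean value theorem the two slopes are values
of [g'], which is nonincreasing. *)
Lemma Bernstein_slope_le (g : R -> R) (a x y : R) :
  Bernstein g -> 0 < a -> a < x -> x < y ->
  (g y - g x) * (x - a) <= (g x - g a) * (y - x).
Proof.
intros (_ & Hs & _ & Hs' & Hcm) Ha Hax Hxy.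
assert (MV : forall f u v, smooth_pos f -> 0 < u -> u < v ->
  exists c, u <= c <= v /\ f v - f u = Derive f c * (v - u)).
{ intros f u v Hf Hu Huv.
  assert (Hd : forall t, 0 < t -> ex_derive f t) by exact (Hf 1%nat).
  destruct (MVT_gen f u v (Derive f)) as (c & Hc & E).
  - rewrite Rmin_left, Rmax_right by lra; intros t Ht.
    apply Derive_correct, Hd; lra.
  - rewrite Rmin_left, Rmax_right by lra; intros t Ht.
    apply continuity_pt_filterlim, (ex_derive_continuous f), Hd; lra.
  - rewrite Rmin_left, Rmax_right in Hc by lra; now exists c. }
destruct (MV g a x Hs) as (d & Hd & Ed); try lra.
destruct (MV g x y Hs) as (c & Hc & Ec); try lra.
assert (Hdc : Derive g c <= Derive g d).
{ destruct (Req_dec d c) as [->|Hne]; [lra|].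
  destruct (MV (Derive g) d c Hs') as (e & He & Ee); try lra.
  assert (H := Hcm 1%nat e ltac:(lra)); simpl in H.
  change (Derive (fun x : R => Derive g x) e) with (Derive (Derive g) e) in H.
  nra. }
rewrite Ed, Ec.
assert (0 < (x - a) * (y - x)) by (apply Rmult_lt_0_compat; lra).
nra.
Qed.

(** For small [x], the chord of [g] over [[x/2, x]] has slope at most
[2 K x^(p-1)], and by concavity so does the chord over [[x, y]].  Hence
[g y - L <= (2 y + 1) K x^(p-1)], and [x] can be sent to [0]. *)
Lemma Bernstein_superlinear_at_0 (g : R -> R) (L K p : R) :
  Bernstein g -> 1 < p ->
  (forall x, 0 < x < 1 -> L <= g x <= L + K * Rpower x p) ->
  forall y, 0 < y -> g y <= L.
Proof.
intros Hg Hp HL y Hy.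
assert (HK : 0 <= K).
{ assert (H := HL (/ 2) ltac:(lra)).
  assert (0 < Rpower (/ 2) p) by apply exp_pos; nra. }
apply Rnot_lt_le; intros Hlt.
set (D := (2 * y + 1) * (K + 1)).
assert (HD : 0 < D) by (unfold D; nra).
set (delta := (g y - L) / D).
assert (Hdelta : 0 < delta) by (apply Rdiv_lt_0_compat; lra).
(* The last bound on [x] makes [(2 y + 1) K x^(p-1)] smaller than [g y - L];
   [K + 1] in place of [K] allows for [K = 0]. *)
set (x := Rmin (Rmin (/ 2) (y / 2)) (Rpower delta (/ (p - 1)))).
assert (Hx1 : x <= / 2) by (eapply Rle_trans; [apply Rmin_l | apply Rmin_l]).
assert (Hxy : x <= y / 2) by (eapply Rle_trans; [apply Rmin_l | apply Rmin_r]).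
assert (Hxd : x <= Rpower delta (/ (p - 1))) by apply Rmin_r.
assert (Hx0 : 0 < x)
  by (repeat apply Rmin_glb_lt; try apply exp_pos; lra).
assert (Hpow : Rpower x (p - 1) <= delta).
{ apply Rle_trans with (Rpower (Rpower delta (/ (p - 1))) (p - 1)).
  - apply Rle_Rpower_l; lra.
  - rewrite Rpower_mult, Rinv_l, Rpower_1 by lra; lra. }
assert (Hxp : Rpower x p = x * Rpower x (p - 1)).
{ rewrite <- (Rpower_1 x Hx0) at 2; rewrite <- Rpower_plus; f_equal; ring. }
assert (Hsl := Bernstein_slope_le g (x / 2) x y Hg
  ltac:(lra) ltac:(lra) ltac:(lra)).
assert (Hb := HL (x / 2) ltac:(lra)).
assert (Hbx := HL x ltac:(lra)).
set (u := Rpower x (p - 1)) in *.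
assert (Hu : 0 < u) by apply exp_pos.
assert (HKu : 0 <= K * u) by nra.
assert (Hgx : g x - g (x / 2) <= x * (K * u)) by (rewrite Hxp in Hbx; lra).
assert (Hgy : g y - g x <= 2 * y * (K * u)).
{ apply Rmult_le_reg_r with (x / 2); [lra|].
  replace (x - x / 2) with (x / 2) in Hsl by field.
  apply Rle_trans with (1 := Hsl).
  apply Rle_trans with (x * (K * u) * y).
  - apply Rle_trans with (x * (K * u) * (y - x)).
    + apply Rmult_le_compat_r; lra.
    + apply Rmult_le_compat_l; [apply Rmult_le_pos; lra | lra].
  - lra. }
assert (Hfin : g y - L <= (2 * y + 1) * (K * u)).
{ rewrite Hxp in Hbx.
  assert (x * (K * u) <= 1 * (K * u)) by (apply Rmult_le_compat_r; lra).
  lra. }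
assert (Heq : g y - L = (2 * y + 1) * ((K + 1) * delta))
  by (unfold delta, D; field; lra).
assert (K * u < (K + 1) * delta) by nra.
nra.
Qed.

(** * Power series of the Bessel functions *)

Definition bessel_coef (mu : R) (k : nat) : R :=
  / (INR (fact k) * Gamma (INR k + mu + 1)).

(** In terms of the variable [q = (z/2)^2] the power [(z/2)^mu] is split off, which
leaves an entire function. *)
Definition bessel_entire (mu q : R) : R :=
  Series (fun k => bessel_coef mu k * q ^ k).

(** [Gamma (k+mu+1)] does not decrease from [k = 1] on, because the factor
[k+mu+1] is then at least [1]; only the step from [k = 0] can go down.  This
lower bound compares the Bessel series with the exponential series. *)
Lemma Gamma_shift_bound (mu : R) : -1 < mu ->
  exists m, 0 < m /\ forall k, m <= Gamma (INR k + mu + 1).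
Proof.
intros Hmu; exists (Rmin (Gamma (mu + 1)) (Gamma (mu + 1 + 1))); split.
- apply Rmin_glb_lt; apply Gamma_pos; lra.
- set (m := Rmin _ _).
  (* Two consecutive values, so that the step only uses factors at least 1. *)
  assert (H : forall k, m <= Gamma (INR k + mu + 1) /\
                        m <= Gamma (INR (S k) + mu + 1)).
  { induction k as [|k [_ IH]].
    - simpl; replace (0 + mu + 1) with (mu + 1) by ring.
      replace (1 + mu + 1) with (mu + 1 + 1) by ring.
      split; [apply Rmin_l | apply Rmin_r].
    - split; [exact IH|].
      assert (Hk := pos_INR k).
      rewrite S_INR in IH |- *; rewrite S_INR.
      replace (INR k + 1 + 1 + mu + 1) with ((INR k + 1 + mu + 1) + 1) by ring.
      rewrite Gamma_succ by lra.
      assert (0 < Gamma (INR k + 1 + mu + 1)) by (apply Gamma_pos; lra).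
      nra. }
  intros k; exact (proj1 (H k)).
Qed.

Lemma bessel_coef_pos (mu : R) (k : nat) : -1 < mu -> 0 < bessel_coef mu k.
Proof.
intros Hmu; apply Rinv_0_lt_compat, Rmult_lt_0_compat.
- apply INR_fact_lt_0.
- apply Gamma_pos; assert (H := pos_INR k); lra.
Qed.

Lemma ex_series_bessel (mu q : R) : -1 < mu -> 0 <= q ->
  ex_series (fun k => bessel_coef mu k * q ^ k).
Proof.
intros Hmu Hq; destruct (Gamma_shift_bound mu Hmu) as (m & Hm & Hle).
apply (ex_series_le (K := R_AbsRing) (V := R_CompleteNormedModule) _
  (fun k => / m * (/ INR (fact k) * q ^ k))).
- intros k; assert (Hc := bessel_coef_pos mu k Hmu).
  assert (Hqk : 0 <= q ^ k) by now apply pow_le.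
  change (Rabs (bessel_coef mu k * q ^ k) <= / m * (/ INR (fact k) * q ^ k)).
  rewrite Rabs_pos_eq by (apply Rmult_le_pos; lra).
  rewrite <- Rmult_assoc; apply Rmult_le_compat_r; [exact Hqk|].
  assert (Hf := INR_fact_lt_0 k).
  unfold bessel_coef; rewrite <- Rinv_mult.
  apply Rinv_le_contravar; [now apply Rmult_lt_0_compat|].
  rewrite Rmult_comm; apply Rmult_le_compat_l; [lra | apply Hle].
- apply (ex_series_scal_l (V := R_NormedModule)).
  exists (exp q); generalize (is_exp_Reals q); apply is_series_ext.
  intros k; rewrite pow_n_pow; apply Rmult_comm.
Qed.

Lemma bessel_entire_ge_coef0 (mu q : R) : -1 < mu -> 0 <= q ->
  bessel_coef mu 0 <= bessel_entire mu q.
Proof.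
intros Hmu Hq; unfold bessel_entire.
assert (Hex := ex_series_bessel mu q Hmu Hq).
rewrite Series_incr_1 by exact Hex.
assert (0 <= Series (fun k => bessel_coef mu (S k) * q ^ S k)).
{ rewrite <- (Rmult_0_l (Series (fun k => bessel_coef mu (S k) * q ^ S k))).
  rewrite <- Series_scal_l; apply Series_le.
  - intros k; assert (0 < bessel_coef mu (S k)) by now apply bessel_coef_pos.
    assert (0 <= q ^ S k) by now apply pow_le.
    assert (0 <= bessel_coef mu (S k) * q ^ S k) by (apply Rmult_le_pos; lra).
    lra.
  - now apply (ex_series_incr_1 (fun k => bessel_coef mu k * q ^ k)). }
rewrite pow_O; lra.
Qed.

Lemma bessel_entire_le (mu q r : R) : -1 < mu -> 0 <= q -> q <= r ->
  bessel_entire mu q <= bessel_entire mu r.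
Proof.
intros Hmu Hq Hqr; apply Series_le; [|apply ex_series_bessel; lra].
intros k; assert (Hc := bessel_coef_pos mu k Hmu); split.
- apply Rmult_le_pos; [lra | now apply pow_le].
- apply Rmult_le_compat_l; [lra | now apply pow_incr].
Qed.

Lemma bessel_coef_lower (nu : R) (k : nat) : -1 < nu ->
  bessel_coef nu k = (nu + 1) * bessel_coef (nu + 1) k
                     + INR k * bessel_coef (nu + 1) k.
Proof.
intros Hnu; unfold bessel_coef; assert (Hk := pos_INR k).
replace (INR k + (nu + 1) + 1) with (INR k + nu + 1 + 1) by ring.
rewrite (Gamma_succ (INR k + nu + 1)) by lra.
assert (0 < Gamma (INR k + nu + 1)) by (apply Gamma_pos; lra).
assert (0 < INR (fact k)) by apply INR_fact_lt_0.
field; repeat split; lra.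
Qed.

Lemma bessel_coef_succ (mu : R) (k : nat) :
  -1 < mu -> INR (S k) * bessel_coef mu (S k) = bessel_coef (mu + 1) k.
Proof.
intros Hmu; unfold bessel_coef; assert (Hk := pos_INR k).
rewrite fact_simpl, mult_INR.
replace (INR (S k) + mu + 1) with (INR k + (mu + 1) + 1) by (rewrite S_INR; ring).
assert (0 < Gamma (INR k + (mu + 1) + 1)) by (apply Gamma_pos; lra).
assert (0 < INR (fact k)) by apply INR_fact_lt_0.
assert (0 < INR (S k)) by (rewrite S_INR; lra).
field; repeat split; lra.
Qed.

(** Coefficientwise, [Gamma (k+nu+2) = (k+nu+1) Gamma (k+nu+1)] splits the
coefficient for [nu] as [(nu+1) + k] times the one for [nu+1]; in the second part
[k] cancels against [k!], which shifts the index and raises the order to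
[nu+2]. *)
Lemma bessel_entire_rec (nu q : R) : -1 < nu -> 0 <= q ->
  bessel_entire nu q =
  (nu + 1) * bessel_entire (nu + 1) q + q * bessel_entire (nu + 1 + 1) q.
Proof.
intros Hnu Hq; unfold bessel_entire.
set (d := fun k => INR k * bessel_coef (nu + 1) k * q ^ k).
assert (Hd : forall k, d (S k) = q * (bessel_coef (nu + 1 + 1) k * q ^ k)).
{ intros k; unfold d; rewrite bessel_coef_succ by lra; simpl; ring. }
assert (Hexd : ex_series d).
{ apply ex_series_incr_1.
  apply (ex_series_ext (fun k => q * (bessel_coef (nu + 1 + 1) k * q ^ k))).
  - intros k; symmetry; apply Hd.
  - apply (ex_series_scal_l (V := R_NormedModule)), ex_series_bessel; lra. }
rewrite <- (Series_scal_l q), <- (Series_scal_l (nu + 1)).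
rewrite <- (Series_ext _ _ Hd).
replace (Series (fun k => d (S k))) with (Series d)
  by (rewrite Series_incr_1 by exact Hexd; unfold d at 1; simpl; ring).
rewrite <- Series_plus; [| |exact Hexd].
- apply Series_ext; intros k; unfold d.
  rewrite bessel_coef_lower by exact Hnu; ring.
- apply (ex_series_scal_l (V := R_NormedModule)), ex_series_bessel; lra.
Qed.

Lemma BesselI_entire (mu z : R) : 0 < z ->
  BesselI mu z = Rpower (z / 2) mu * bessel_entire mu ((z / 2) ^ 2).
Proof.
intros Hz; unfold BesselI, bessel_entire; rewrite <- Series_scal_l.
apply Series_ext; intros k.
replace (2 * INR k + mu) with (mu + INR (2 * k)) by (rewrite mult_INR; simpl; ring).
rewrite Rpower_plus, Rpower_pow, pow_mult by lra.
unfold bessel_coef, Rdiv; ring.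
Qed.

(** * Behaviour of [W] at the origin *)

Lemma W_eq (nu z : R) : -1 < nu -> 0 < z ->
  W nu z = 2 * (nu + 1) + 2 * (z / 2) ^ 2 *
    (bessel_entire (nu + 1 + 1) ((z / 2) ^ 2)
     / bessel_entire (nu + 1) ((z / 2) ^ 2)).
Proof.
intros Hnu Hz; unfold W.
rewrite !BesselI_entire by exact Hz.
set (q := (z / 2) ^ 2).
assert (Hq : 0 <= q) by (apply pow_le; lra).
rewrite (bessel_entire_rec nu q) by lra.
rewrite Rpower_plus, Rpower_1 by lra.
assert (H1 := bessel_entire_ge_coef0 (nu + 1) q ltac:(lra) Hq).
assert (H2 := bessel_coef_pos (nu + 1) 0 ltac:(lra)).
assert (H3 : 0 < Rpower (z / 2) nu) by apply exp_pos.
field; repeat split; lra.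
Qed.

(** The ratio of the two series is positive, and at most the numerator at [q = 1]
over the constant term of the denominator, since both series have positive
coefficients. *)
Lemma W_bounds (nu : R) : -1 < nu ->
  exists K, forall z, 0 < z < 1 ->
    2 * (nu + 1) < W nu z <= 2 * (nu + 1) + K * z ^ 2.
Proof.
intros Hnu.
exists (bessel_entire (nu + 1 + 1) 1 / bessel_coef (nu + 1) 0).
intros z Hz; rewrite W_eq by lra.
set (q := (z / 2) ^ 2).
assert (Hq : 0 < q) by (apply pow_lt; lra).
assert (Hqz : q = z ^ 2 / 4) by (unfold q; field).
assert (Hq1 : q <= 1) by (rewrite Hqz; nra).
assert (Hb := bessel_entire_ge_coef0 (nu + 1) q ltac:(lra) ltac:(lra)).
assert (Hb0 := bessel_coef_pos (nu + 1) 0 ltac:(lra)).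
assert (Hc := bessel_entire_ge_coef0 (nu + 1 + 1) q ltac:(lra) ltac:(lra)).
assert (Hc0 := bessel_coef_pos (nu + 1 + 1) 0 ltac:(lra)).
assert (Hc1 := bessel_entire_le (nu + 1 + 1) q 1 ltac:(lra) ltac:(lra) Hq1).
set (B := bessel_entire (nu + 1) q) in *.
set (C := bessel_entire (nu + 1 + 1) q) in *.
set (C1 := bessel_entire (nu + 1 + 1) 1) in *.
set (b := bessel_coef (nu + 1) 0) in *.
assert (Hr : 0 < C / B) by (apply Rdiv_lt_0_compat; lra).
assert (Hr' : C / B <= C1 / b).
{ apply Rmult_le_compat; try lra.
  - apply Rlt_le, Rinv_0_lt_compat; lra.
  - apply Rinv_le_contravar; lra. }
split; [nra|].
assert (2 * q * (C / B) <= 2 * q * (C1 / b)) by (apply Rmult_le_compat_l; lra).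
nra.
Qed.

(** * The composition with a power *)

Theorem proposition3p3 (nu tau : R) (Hnu : -1 < nu) (Htau : 1 / 2 < tau) :
  ~ Bernstein (fun x : R => W nu (Rpower x tau)).
Proof.
intros Hg; destruct (W_bounds nu Hnu) as (K & HK).
assert (Hpow : forall x, 0 < x < 1 -> 0 < Rpower x tau < 1).
{ intros x Hx; split; [apply exp_pos|].
  replace 1 with (Rpower 1 tau)
    by (unfold Rpower; rewrite ln_1, Rmult_0_r; apply exp_0).
  apply Rlt_Rpower_l; lra. }
assert (Hle : W nu (Rpower (/ 2) tau) <= 2 * (nu + 1)).
{ apply (Bernstein_superlinear_at_0 _ (2 * (nu + 1)) K (tau * 2) Hg);
    [lra | | lra].
  intros x Hx; cbv beta.
  replace (Rpower x (tau * 2)) with (Rpower x tau ^ 2).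
  - assert (H := HK (Rpower x tau) (Hpow x Hx)); lra.
  - rewrite <- Rpower_mult, <- (Rpower_pow 2) by apply exp_pos; reflexivity. }
assert (H := HK (Rpower (/ 2) tau) (Hpow (/ 2) ltac:(lra))); lra.
Qed.
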